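(* The set $\mathscr{A}:=\{x\in\mathscr{Z} : \forall y\in\mathscr{Y},\ x\not\sim y\}$ is comeager in $\mathscr{Z}$, that is, $\mathscr{Z}\setminus\mathscr{A}$ is a set of first Baire category in $\mathscr{Z}$. In particular, $\mathscr{A}$ is uncountable.
   Context: $\mathbf{N}$ denotes the set of positive integers. $\mathscr{X}$ is the set of all sequences $x=(x_n)_{n\in\mathbf{N}}$ of strictly positive real numbers such that $\sum_n x_n=\infty$. For $x\in\mathscr{X}$, let $\mathcal{I}_x:=\{A\subseteq\mathbf{N} : \sum_{n\in A}x_n<\infty\}$. For $x,y\in\mathscr{X}$, write $x\sim y$ if $\mathcal{I}_x=\mathcal{I}_y$, i.e., if for all $A\subseteq\mathbf{N}$, $\sum_{n\in A}x_n<\infty$ if and only if $\sum_{n\in A}y_n<\infty$. Define $\mathscr{Z}:=\mathscr{X}\cap c_0=\{x\in\mathscr{X} : \lim_{n\to\infty}x_n=0\}$ and $\mathscr{Y}:=\{y\in\mathscr{X} : \liminf_{n\to\infty} y_{n+1}/y_n>0\}$. Here $c_0$ is the Banach space of real sequences converging to $0$ with the supremum norm, and $\mathscr{Z}$ is endowed with the subspace topology inherited from $c_0$; it is a $G_\delta$-subset of $c_0$, hence completely metrizable. *)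

(* Defs.v *)
From HB Require Import structures.
From mathcomp Require Import all_boot all_order all_algebra.
From mathcomp Require Import all_classical all_reals all_analysis.

Set Implicit Arguments.
Unset Strict Implicit.
Unset Printing Implicit Defensive.

Import Order.TTheory GRing.Theory Num.Theory.
Import numFieldNormedType.Exports.

Local Open Scope classical_set_scope.
Local Open Scope ring_scope.

Section Category.
Context {T : topologicalType}.
Implicit Type A : set T.

Definition nowhere_dense A := interior (closure A) = set0.

Definition meager A := exists F : (set T)^nat,
  (forall n, nowhere_dense (F n)) /\ A = \bigcup_n F n.

Definition comeager A := meager (~` A).

End Category.

Definition null_seq (R : realType) : {pred nat -> R} :=
  [pred u : nat -> R | `[< u @ \oo --> (0 : R) >]].

Section c0.
Context {R : realType}.

Lemma null_seq_submod_closed : submod_closed (@null_seq R).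
Proof.
split; first by apply/asboolP; exact: cvg_cst.
move=> a u v /asboolP u0 /asboolP v0; apply/asboolP.
rewrite -[X in _ --> X]addr0 -[X in _ --> X + _](mulr0 a).
by apply: cvgD => //; apply: cvgM => //; exact: cvg_cst.
Qed.

HB.instance Definition _ :=
  GRing.isSubmodClosed.Build R (nat -> R) (@null_seq R) null_seq_submod_closed.

Record c0 := C0 { c0_val :> nat -> R ; _ : c0_val \in @null_seq R }.

HB.instance Definition _ := [isSub for c0_val].
HB.instance Definition _ := [Choice of c0 by <:].
HB.instance Definition _ := [SubChoice_isSubLmodule of c0 by <:].

Lemma c0_cvg (u : c0) : (u : nat -> R) @ \oo --> (0 : R).
Proof. exact/asboolP/(valP u). Qed.

Definition c0_norm (u : c0) : R := sup (range (fun n => `|u n|)).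

Lemma c0_has_sup (u : c0) : has_sup (range (fun n => `|u n|)).
Proof.
split; first by exists `|u 0%N|, 0%N.
have /cvg_seq_bounded [M [_ Mu]] : cvgn (u : nat -> R).
  by apply/cvg_ex; exists 0; exact: c0_cvg.
by exists (M + 1) => _ [n _ <-]; apply: Mu => //; rewrite ltrDl.
Qed.

Lemma c0_norm_ub (u : c0) n : `|u n| <= c0_norm u.
Proof. by apply: ub_le_sup; [have [] := c0_has_sup u|exists n]. Qed.

Lemma c0_norm_le (u : c0) M : (forall n, `|u n| <= M) -> c0_norm u <= M.
Proof.
move=> uM; apply: ge_sup; first by have [] := c0_has_sup u.
by move=> _ [n _ <-].
Qed.

Lemma c0_ler_normD (u v : c0) : c0_norm (u + v) <= c0_norm u + c0_norm v.
Proof.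
apply: c0_norm_le => n; apply: le_trans (ler_normD (u n) (v n)) _.
by apply: lerD; exact: c0_norm_ub.
Qed.

Lemma c0_normZ a (u : c0) : c0_norm (a *: u) = `|a| * c0_norm u.
Proof.
have le b w : c0_norm (b *: w) <= `|b| * c0_norm w.
  apply: c0_norm_le => n.
  have -> : (b *: w : c0) n = b * w n by [].
  by rewrite normrM; apply: ler_wpM2l => //; exact: c0_norm_ub.
apply/eqP; rewrite eq_le le /=.
have [->|a0] := eqVneq a 0.
  by rewrite normr0 mul0r; exact: le_trans (c0_norm_ub _ 0%N).
rewrite -ler_pdivlMl ?normr_gt0// -normfV.
by rewrite -[in leLHS](scalerK a0 u) le.
Qed.

Lemma c0_norm_eq0 (u : c0) : c0_norm u = 0 -> u = 0.
Proof.
move=> u0; apply: val_inj; apply/funext => n /=; apply/eqP.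
by rewrite -normr_eq0 eq_le normr_ge0 andbT -u0 c0_norm_ub.
Qed.

HB.instance Definition _ :=
  Lmodule_isNormed.Build R c0 c0_ler_normD c0_normZ c0_norm_eq0.

End c0.
Arguments c0 : clear implicits.

Section Spaces.
Context (R : realType).

(* Sequences are indexed from 0: [x n] stands for the term of index n + 1. *)
Definition scrX : set (nat -> R) :=
  [set x | (forall n, 0 < x n) /\ (\sum_(n <oo) (x n)%:E = +oo)%E].

Definition summable_ideal (x : nat -> R) : set (set nat) :=
  [set A | (\sum_(n <oo | n \in A) (x n)%:E < +oo)%E].

Definition ideal_equiv (x y : nat -> R) :=
  summable_ideal x = summable_ideal y.

Definition scrY : set (nat -> R) :=
  [set y | scrX y /\ (0 < limn_einf (fun n => (y n.+1 / y n)%:E))%E].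

(* As a type, [scrZ] carries the subspace topology inherited from [c0 R]. *)
Definition scrZ : set (c0 R) := [set x | scrX x].

Definition scrA : set scrZ :=
  [set x | forall y, scrY y -> ~ ideal_equiv (set_val x : c0 R) y].

End Spaces.
Arguments scrZ : clear implicits.
Arguments scrA : clear implicits.

(* Main.v *)
(** If [y] is in [scrY] then [c * y n <= y n.+1] for some [c > 0] and all [n], so
    the ideal of [y] has the property that if [A + 1] is in it then so is [A].
    Hence [x] is equivalent to no such [y] as soon as, for some set [B], the sum
    of [x (2j)] over [j] in [B] diverges while the sum of [x (2j+1)] over [j] in
    [B] converges.  This happens whenever, for each [k], there is an interval
    beyond [k] on which the even terms have sum > 1 and the odd terms have sum
    < 2^-k; for fixed [k] that condition is open, involving finitely many
    coordinates, and dense, as it can be forced by an arbitrarily small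
    modification of finitely many terms of a null sequence.  Uncountability
    needs no Baire argument: interleaving [t / (n + 1)] and [t / 2^n] gives an
    element of [scrA] with first term [t], for every [t > 0]. *)

Require Import Defs.
From mathcomp Require Import all_boot all_order all_algebra.
From mathcomp Require Import all_classical all_reals all_analysis.
From mathcomp Require Import lra zify.

Set Implicit Arguments.
Unset Strict Implicit.
Unset Printing Implicit Defensive.

Import Order.TTheory GRing.Theory Num.Theory.
Import numFieldNormedType.Exports.

Local Open Scope classical_set_scope.
Local Open Scope ring_scope.

(** * Ideals through bounded partial sums, and the parity criterion *)

Section BoundedSums.
Context {R : realType}.
Implicit Types (x y : nat -> R) (P B : pred nat).

(** A real-valued form of finiteness for series of nonnegative terms, so that later comparisons
    involve finite sums only. *)
Definition bounded_sums x P :=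
  exists M, forall n, \sum_(0 <= i < n | P i) x i <= M.

Lemma nneseries_lt_pinftyP x P : (forall n, 0 <= x n) ->
  (\sum_(n <oo | P n) (x n)%:E < +oo)%E <-> bounded_sums x P.
Proof.
move=> x0; set S := (X in (X < _)%E); split=> [Soo|[M xM]].
  have xS n : (\sum_(0 <= i < n | P i) (x i)%:E <= S)%E.
    by apply: nneseries_lim_ge => i _ _; rewrite lee_fin.
  have S0 : (0 <= S)%E by apply: le_trans (xS 0%N); rewrite big_nil.
  exists (fine S) => n; rewrite -lee_fin fineK; first by rewrite -sumEFin.
  by rewrite ge0_fin_numE.
apply: (@le_lt_trans _ _ M%:E); last exact: ltry.
apply: lime_le; first by apply: is_cvg_nneseries_cond => i _ _; rewrite lee_fin.
by apply: nearW => n; rewrite sumEFin lee_fin.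
Qed.

Lemma summable_idealP x P : (forall n, 0 < x n) ->
  summable_ideal x [set n | P n] <-> bounded_sums x P.
Proof.
move=> x0; rewrite -nneseries_lt_pinftyP; last by move=> n; exact: ltW.
rewrite /summable_ideal /=; under eq_eseriesl do rewrite mem_setE.
by [].
Qed.

Lemma ideal_equiv_bounded_sums x y P :
  (forall n, 0 < x n) -> (forall n, 0 < y n) -> ideal_equiv x y ->
  bounded_sums x P <-> bounded_sums y P.
Proof. by move=> x0 y0 xy; rewrite -!summable_idealP// xy. Qed.

Lemma le_sum_nat x P m n : (forall n, 0 <= x n) -> (m <= n)%N ->
  \sum_(0 <= i < m | P i) x i <= \sum_(0 <= i < n | P i) x i.
Proof.
move=> x0 mn; rewrite [leRHS](big_cat_nat (n := m))//= lerDl.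
by apply: sumr_ge0.
Qed.

Lemma sum_parity (b : bool) x B n :
  \sum_(0 <= i < n.*2 | (odd i == b) && B i./2) x i =
  \sum_(0 <= j < n | B j) x (b + j.*2)%N.
Proof.
rewrite big_mkcond [RHS]big_mkcond/=; elim: n => [|n IHn].
  by rewrite !big_nil.
rewrite doubleS !big_nat_recr//= {}IHn uphalf_double doubleK odd_double.
by case: b => /=; rewrite ?addr0.
Qed.

Lemma bounded_sums_parity (b : bool) x B : (forall n, 0 <= x n) ->
  bounded_sums x [pred i | (odd i == b) && B i./2] <->
  bounded_sums (fun j => x (b + j.*2)%N) B.
Proof.
move=> x0; split=> -[M xM]; exists M => n.
  by rewrite -sum_parity; exact: xM.
apply: le_trans (xM n); rewrite -sum_parity; apply: le_sum_nat => //.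
by rewrite -addnn leq_addr.
Qed.

(** A positive lower limit only bounds the ratios from some [N] on. The threshold is then brought
    down to 0 one index at a time, each step replacing the constant by its minimum with one more
    positive ratio. *)
Lemma limn_einf_ratio_gt0 y : (forall n, 0 < y n) ->
  (0 < limn_einf (fun n => (y n.+1 / y n)%:E))%E ->
  exists2 c, 0 < c & forall n, c * y n <= y n.+1.
Proof.
move=> y0; rewrite limn_einf_lim (cvg_lim _ (@cvg_einfs_sup _ _))//.
move=> /ereal_sup_gt[_ [N _ <-] einf0].
have [r r0 rN] : exists2 r, 0 < r & forall n, (N <= n)%N -> r * y n <= y n.+1.
  have einf_le n : (N <= n)%N ->
      (einfs (fun n => (y n.+1 / y n)%:E) N <= (y n.+1 / y n)%:E)%E.
    by move=> Nn; apply: ereal_inf_lbound; exists n.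
  case: (einfs _ N) einf0 einf_le => [r||] // + einf_le.
  - rewrite lte_fin => r0; exists r => // n /einf_le.
    by rewrite lee_fin ler_pdivlMr.
  (* The infimum cannot be [+oo], being at most a real ratio. *)
  - by have := einf_le N (leqnn N).
elim: N {einf0} r r0 rN => [r r0 rN|N IHN r r0 rN].
  by exists r => // n; exact: rN.
apply: (IHN (Num.min r (y N.+1 / y N))).
- by rewrite lt_min r0 divr_gt0.
- move=> n; rewrite leq_eqVlt => /predU1P[<-|Nn].
    by rewrite -ler_pdivlMr// ge_min lexx orbT.
  by apply: le_trans (rN n Nn); rewrite ler_pM2r// ge_min lexx.
Qed.

(** If [x] and [y] were equivalent, convergence along the odd indices would pass from [x] to [y],
    then to the even indices of [y] by [c * y n <= y n.+1], and back to [x], contradicting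
    divergence there. *)
Lemma not_ideal_equiv_parity x B : (forall n, 0 < x n) ->
  ~ bounded_sums (fun j => x j.*2) B -> bounded_sums (fun j => x j.*2.+1) B ->
  forall y, scrY y -> ~ ideal_equiv x y.
Proof.
move=> x0 xeven xodd y [[y0 _] /(limn_einf_ratio_gt0 y0)[c c0 cy]] xy.
have x0' n : 0 <= x n by exact: ltW.
have y0' n : 0 <= y n by exact: ltW.
apply: xeven; rewrite -(bounded_sums_parity false)//.
apply/(ideal_equiv_bounded_sums _ x0 y0 xy)/bounded_sums_parity => //=.
move: xodd; rewrite -(bounded_sums_parity true)//.
move=> /(ideal_equiv_bounded_sums _ x0 y0 xy)/bounded_sums_parity[//|M yM].
exists (c^-1 * M) => n; rewrite ler_pdivlMl//.
by apply: le_trans (yM n); rewrite mulr_sumr; apply: ler_sum => i _; exact: cy.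
Qed.

End BoundedSums.

(** * Gluing blocks into one index set *)

Lemma normr_half_lt1 (R : realType) : `|2^-1| < 1 :> R.
Proof. by rewrite ger0_norm ?invr_ge0// invf_lt1 ?ltr1n. Qed.

Lemma blocks_bounded_sums (R : realType) (x : nat -> R) :
  (forall n, 0 < x n) ->
  (forall k, exists a b, [/\ (k <= a)%N, 1 < \sum_(a <= i < b) x i.*2 &
                             \sum_(a <= i < b) x i.*2.+1 < 2^-1 ^+ k]) ->
  exists B : pred nat, ~ bounded_sums (fun j => x j.*2) B /\
                       bounded_sums (fun j => x j.*2.+1) B.
Proof.
move=> x0 /choice[a /choice[b abP]].
(* [B] is the union of all blocks: as [k <= a k <= i] on block [k], bounding [k] by [i] loses
   nothing and keeps [B] boolean. *)
pose B i := [exists k : 'I_i.+1, (a k <= i < b k)%N].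
have BP i k : (a k <= i < b k)%N -> B i.
  move=> iab; have [ka _ _] := abP k; have /andP[ai _] := iab.
  by apply/existsP; exists (Ordinal (leq_trans ka ai : (k < i.+1)%N)).
have x0' n : 0 <= x n by exact: ltW.
exists B; split=> [[M xM]|].
  have [n nM] : exists n, M < n%:R :> R.
    exists (Num.bound `|M|).
    exact: le_lt_trans (ler_norm M) (archi_boundP _).
  suff [N] : exists N, n%:R <= \sum_(0 <= i < N | B i) x i.*2.
    by move=> /(lt_le_trans nM); rewrite ltNge xM.
  (* Block [N] starts no earlier than [N], hence after the terms already summed, and contributes
     more than 1. *)
  elim: n {nM} => [|n [N nN]]; first by exists 0%N; rewrite big_nil.
  have [Na sum_gt1 _] := abP N; exists (b N).
  have [ab|/ltnW ba] := leqP (a N) (b N); last first.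
    by move: sum_gt1; rewrite big_geq// ltNge ler01.
  rewrite (big_cat_nat (n := a N))//= -natr1 lerD//.
    by apply: le_trans nN _; exact: le_sum_nat.
  apply: le_trans (ltW sum_gt1) _.
  rewrite [leRHS]big_mkcond/= !big_nat; apply: ler_sum => i iab.
  by rewrite (BP _ _ iab).
exists (1 / (1 - 2^-1)) => n.
apply: le_trans (geometric_le_lim n _ _ _) => //; last exact: normr_half_lt1.
rewrite /series /=.
(* Blocks may overlap: counting each index once per block containing it only enlarges the sum, and
   exchanging the sums then bounds it block by block by a geometric series. *)
apply: (@le_trans _ _ (\sum_(0 <= i < n)
    \sum_(0 <= k < n | (a k <= i < b k)%N) x i.*2.+1)).
  rewrite big_mkcond/= !big_nat; apply: ler_sum => i /= ni.
  case: ifPn => [/existsP[k ikm]|_]; last exact: sumr_ge0.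
  have kn : (k < n)%N by rewrite (leq_ltn_trans _ ni)// -ltnS.
  by rewrite big_mkord (bigD1 (Ordinal kn))//= lerDl sumr_ge0.
rewrite (exchange_big_dep_nat xpredT)//=.
rewrite !big_nat; apply: ler_sum => k /= kn; rewrite mul1r.
have [_ _ /ltW/(le_trans _)] := abP k; apply.
(* The cut at [n] may fall inside block [k], so both sums are extended to a common range and
   compared termwise. *)
rewrite (big_nat_widenl (a k) 0)//.
rewrite [leRHS](big_nat_widen _ _ (maxn n (b k))) ?leq_maxr//.
rewrite [leLHS](big_nat_widen _ _ (maxn n (b k))) ?leq_maxl//.
rewrite [leLHS]big_mkcond [leRHS]big_mkcond/=; apply: ler_sum => i _.
by case: (i < n)%N; rewrite ?andbT ?andbF//=; case: ifP => //.
Qed.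

(** * Baire category in [scrZ] *)

Section Generic.
Context {R : realType}.
Implicit Types (z : scrZ R) (k m n : nat).

Definition coord n z : R := (set_val z : c0 R) n.

Lemma coord_gt0 n z : 0 < coord n z.
Proof. by have [x0 _] : scrX (set_val z : c0 R) := set_valP z; exact: x0. Qed.

Lemma c0_eval_continuous n : continuous (fun u : c0 R => u n).
Proof.
move=> u; have uF : Filter (nbhs u) by exact: nbhs_filter.
apply/(cvgrPdist_lt (FF := uF)) => e e0.
apply/nbhs_ballP; exists e => //= v; rewrite -ball_normE.
by apply: le_lt_trans; exact: (c0_norm_ub (u - v)).
Qed.

Lemma coord_continuous n : continuous (coord n).
Proof.
move=> z; apply: (@continuous_comp _ _ _ (set_val : scrZ R -> c0 R)
  (fun u : c0 R => u n)); first exact: initial_continuous.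
exact: c0_eval_continuous.
Qed.

Lemma sum_coord_continuous (f : nat -> nat) (s : seq nat) :
  continuous (fun z => \sum_(i <- s) coord (f i) z).
Proof.
move=> z; elim: s => [|i s IHs].
  by under eq_fun do rewrite big_nil; exact: cst_continuous.
under eq_fun do rewrite big_cons; apply: continuousD => //.
exact: coord_continuous.
Qed.

Definition big_block k : set (scrZ R) := [set z | exists a b,
  [/\ (k <= a)%N, 1 < \sum_(a <= i < b) coord i.*2 z &
      \sum_(a <= i < b) coord i.*2.+1 z < 2^-1 ^+ k]].

(** The same [a] and [b] serve for all nearby points, since two strict inequalities between
    continuous finite sums persist. *)
Lemma big_block_open k : open (big_block k).
Proof.
rewrite openE => z [a [b [ka z1 zk]]]; near=> w.
exists a, b; split=> //; near: w.
- exact: (cvgr_gt _ (@sum_coord_continuous _ _ z)).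
- exact: (cvgr_lt _ (@sum_coord_continuous _ _ z)).
Unshelve. all: by end_near. Qed.

Lemma scrA_big_block z : (forall k, big_block k z) -> scrA R z.
Proof.
move=> zb; have z0 n : 0 < (set_val z : c0 R) n := coord_gt0 n z.
have [B [Beven Bodd]] := blocks_bounded_sums z0 zb.
exact: not_ideal_equiv_parity z0 Beven Bodd.
Qed.

Lemma scrXP (x : nat -> R) : scrX x <->
  (forall n, 0 < x n) /\ ~ bounded_sums x xpredT.
Proof.
split=> -[x0 xS]; split=> //.
  by rewrite -nneseries_lt_pinftyP ?xS// => n; exact: ltW.
apply/eqP; rewrite -leye_eq leNgt; apply/negP.
by rewrite nneseries_lt_pinftyP// => n; exact: ltW.
Qed.

(** The terms that may differ cost at most the sum of the first [N] terms of [y]. *)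
Lemma bounded_sums_eventually (x y : nat -> R) N :
  (forall n, 0 <= x n) -> (forall n, 0 <= y n) ->
  (forall n, (N <= n)%N -> x n = y n) ->
  bounded_sums x xpredT -> bounded_sums y xpredT.
Proof.
move=> x0 y0 xy [M xM]; exists (\sum_(0 <= i < N) y i + M) => n.
apply: (@le_trans _ _ (\sum_(0 <= i < N + n) y i)).
  by apply: le_sum_nat => //; exact: leq_addl.
rewrite (big_cat_nat (n := N)) ?leq_addr//= lerD2l.
rewrite (@eq_big_nat _ _ _ _ _ _ x) => [|i /andP[Ni _]]; last by rewrite xy.
apply: le_trans (xM (N + n)%N).
by rewrite [leRHS](big_cat_nat (n := N)) ?leq_addr//= lerDr sumr_ge0.
Qed.

Definition perturb a b (eta delta : R) (x : nat -> R) n :=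
  if (a.*2 <= n < b.*2)%N then if odd n then delta else eta else x n.

Lemma perturb_null_seq a b eta delta (u : c0 R) :
  perturb a b eta delta u \in @null_seq R.
Proof.
apply/asboolP; apply: cvg_trans (c0_cvg u); apply: near_eq_cvg.
exists b.*2 => // n /= bn; rewrite /perturb ifF//.
by apply/negbTE; rewrite negb_and -!leqNgt bn orbT.
Qed.

Lemma perturb_scrX a b eta delta (x : nat -> R) : 0 < eta -> 0 < delta ->
  scrX x -> scrX (perturb a b eta delta x).
Proof.
move=> eta0 delta0 /scrXP[x0 xS].
have p0 n : 0 < perturb a b eta delta x n.
  by rewrite /perturb; case: ifP => // _; case: ifP.
apply/scrXP; split=> //; apply: contra_not xS.
apply: (@bounded_sums_eventually _ _ b.*2) => n; [exact: ltW|exact: ltW|].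
by move=> bn; rewrite /perturb ifF// ltnNge bn andbF.
Qed.

Lemma big_block_dense k z (e : R) : 0 < e ->
  exists2 w, big_block k w & `|set_val z - set_val w : c0 R| < e.
Proof.
move=> e0; set u : c0 R := set_val z.
(* Half of [e] leaves room, since strict coordinatewise bounds give only a non-strict bound on the
   supremum. *)
pose eta := e / 2; have eta0 : 0 < eta by rewrite divr_gt0.
have [N _ uN] := cvgr0_norm_lt _ (c0_cvg u) _ eta0.
(* As [L > eta^-1], [L] even terms equal to [eta] sum to more than 1; dividing by [L.+1] in [delta]
   keeps the sum of [L] odd terms strictly below [2^-1 ^+ k]. *)
pose a := maxn N k; pose L := Num.bound eta^-1.
pose delta := Num.min eta (2^-1 ^+ k / L.+1%:R).
have delta0 : 0 < delta by rewrite lt_min eta0 divr_gt0// exprn_gt0// invr_gt0.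
pose v : c0 R := C0 (perturb_null_seq a (a + L) eta delta u).
have vX : scrX v by apply: perturb_scrX => //; exact: (set_valP z).
pose w : scrZ R := exist _ v (mem_set vX).
exists w.
  have ble i : (a <= i < a + L)%N ->
    (a.*2 <= i.*2 < (a + L).*2)%N && (a.*2 <= i.*2.+1 < (a + L).*2)%N.
    by lia.
  exists a, (a + L)%N; split; first exact: leq_maxr.
  - rewrite (@eq_big_nat _ _ _ _ _ _ (fun=> eta)).
      rewrite big_const_nat iter_addr_0 addKn -mulr_natl -ltr_pdivrMr// mul1r.
      by apply: archi_boundP; rewrite invr_ge0 ltW.
    move=> i /ble /andP[ib _].
    by rewrite /coord /= /perturb ib odd_double.
  - rewrite (@eq_big_nat _ _ _ _ _ _ (fun=> delta)).
      rewrite big_const_nat iter_addr_0 addKn -[delta *+ L]mulr_natl.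
      apply: (@lt_le_trans _ _ (L.+1%:R * delta)).
        by rewrite ltr_pM2r// ltr_nat.
      by rewrite mulrC -ler_pdivlMr// ge_min lexx orbT.
    move=> i /ble /andP[_ ib].
    by rewrite /coord /= /perturb ib/= odd_double.
rewrite (@le_lt_trans _ _ eta)//; last by rewrite ltr_pdivrMr// ltr_pMr// ltr1n.
apply: c0_norm_le => n; rewrite [leLHS](_ : _ = `|u n - v n|)//= /perturb.
case: ifPn => [/andP[an _]|_]; last by rewrite subrr normr0 ltW.
(* Old and new terms both lie between 0 and [eta], so they differ by at most [eta]. *)
have : `|u n| < eta by apply: uN => /=; lia.
have : 0 < u n by exact: coord_gt0.
have : delta <= eta by rewrite ge_min lexx.
move: delta0; rewrite ltr_norml ler_norml; case: ifP => _; lra.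
Qed.

Lemma big_block_nbhs k z (U : set (scrZ R)) : nbhs z U ->
  (big_block k `&` U) !=set0.
Proof.
move=> [B [[A oA <-] Az AU]].
have /nbhs_ballP[e /= e0 eA] : nbhs (set_val z : c0 R) A.
  exact: open_nbhs_nbhs.
have [w wk zw] := big_block_dense k z e0.
exists w; split=> //; apply: AU; apply: eA.
by rewrite -ball_normE.
Qed.

(** An interior point of the closure of [F] would, by density, yield a point of [big_block k] in
    that closure; as [big_block k] is open, it would then meet [F]. *)
Lemma nowhere_dense_sub_big_blockC k (F : set (scrZ R)) :
  F `<=` ~` big_block k -> nowhere_dense F.
Proof.
move=> Fk; apply/seteqP; split=> // z /(big_block_nbhs k)[w [wk]].
have /[swap] /[apply] := open_nbhs_nbhs (conj (big_block_open k) wk).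
by move=> [v [/Fk]].
Qed.

Lemma comeager_scrA : comeager (scrA R).
Proof.
(* [meager] requires an equality, so the covering sets are cut down to the complement of [scrA]. *)
exists (fun k => ~` scrA R `&` ~` big_block k); split=> [k|].
  by apply: (@nowhere_dense_sub_big_blockC k) => z [].
rewrite -setI_bigcupr; apply/seteqP; split=> [z zA|z []//].
split=> //; apply: contrapT => zk; apply: zA; apply: scrA_big_block => k.
by apply: contrapT => zkN; apply: zk; exists k.
Qed.

(** * Uncountability by an explicit family *)

Definition witness (t : R) n :=
  t * (if odd n then 2^-1 ^+ n./2 else harmonic n./2).

Lemma witness_gt0 t n : 0 < t -> 0 < witness t n.
Proof.
move=> t0; rewrite mulr_gt0//.
by case: ifP; rewrite ?harmonic_gt0 ?exprn_gt0 ?invr_gt0.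
Qed.

Lemma witness_null_seq t : witness t \in @null_seq R.
Proof.
apply/asboolP; rewrite -[X in _ --> X](mulr0 t).
apply: cvgM; first exact: cvg_cst.
apply/cvgrPdist_lt => e e0.
have [N _ hN] := cvgr0_norm_lt _ (@cvg_harmonic R) _ e0.
have [M _ gM] := cvgr0_norm_lt _ (cvg_expr (normr_half_lt1 R)) _ e0.
exists (maxn N M).*2 => // n /= NMn; rewrite sub0r normrN.
case: ifP => _; [apply: gM|apply: hN] => /=; lia.
Qed.

Lemma witness_even t : 0 < t -> ~ bounded_sums (fun j => witness t j.*2) xpredT.
Proof.
move=> t0 [M tM]; apply: (@dvg_harmonic R); apply: nondecreasing_is_cvgn.
  apply/nondecreasing_seqP => n.
  by rewrite !seriesEnat/= big_nat_recr//= lerDl harmonic_ge0.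
exists (M / t) => _ [n _ <-]; rewrite ler_pdivlMr//.
apply: le_trans (tM n); rewrite seriesEnat/= mulr_suml; apply: ler_sum => i _.
by rewrite /witness odd_double doubleK mulrC.
Qed.

Lemma witness_odd t : 0 < t -> bounded_sums (fun j => witness t j.*2.+1) xpredT.
Proof.
move=> t0; exists (t / (1 - 2^-1)) => n.
apply: le_trans (geometric_le_lim n (ltW t0) _ _) => //; last
  exact: normr_half_lt1.
rewrite seriesEnat/=; apply: ler_sum => i _.
by rewrite /witness /= odd_double /= uphalf_double.
Qed.

Lemma witness_scrX t : 0 < t -> scrX (witness t).
Proof.
move=> t0; apply/scrXP; split=> [n|]; first exact: witness_gt0.
apply: contra_not (witness_even t0) => -[M tM]; exists M => n.
rewrite -(sum_parity false (witness t) xpredT).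
apply: le_trans (tM n.*2); rewrite big_mkcond; apply: ler_sum => i _.
by case: ifP => // _; exact/ltW/witness_gt0.
Qed.

(** The coordinate 0 of [witness t] is [t], so the image of [scrA] under [coord 0] contains the unit
    interval, whose Lebesgue measure is not 0. *)
Lemma uncountable_scrA : ~ countable (scrA R).
Proof.
move=> cA.
suff /countable_lebesgue_measure0 : countable (`]0, 1[%classic : set R).
  rewrite lebesgue_measure_itv/= lte_fin ltr01 oppr0 adde0 => /eqP.
  by rewrite eqe oner_eq0.
apply: sub_countable cA; apply: card_le_trans (card_image_le (coord 0) _).
apply: subset_card_le => t /=; rewrite in_itv/= => /andP[t0 _].
pose z : scrZ R :=
  exist _ (C0 (witness_null_seq t) : c0 R) (mem_set (witness_scrX t0)).
exists z; last by rewrite /coord /= /witness /= invr1 mulr1.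
apply: not_ideal_equiv_parity (witness_even t0) (witness_odd t0) => n.
exact: witness_gt0.
Qed.

End Generic.

Theorem theorem1p4 (R : realType) :
  comeager (scrA R) /\ ~ countable (scrA R).
Proof. by split; [exact: comeager_scrA|exact: uncountable_scrA]. Qed.
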